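(* Let $W$ and $W'$ be non-negative random variables defined on the same probability space and having the same law, let $D := W'-W$, and suppose that $$\mathbb{E}(D|W) = -\lambda(W-1),$$ where $\lambda>0$ is a fixed constant. Let $Z$ be an exponential random variable with mean $1$. Then for every $t>0$, $$\left|\mathbb{P}[W\le t]-\mathbb{P}[Z\le t]\right| \le \frac{\mathbb{E}\left|2\lambda W-\mathbb{E}(D^2|W)\right|}{2\lambda t} + \frac{\mathbb{E}|D|^3\,\max\{t^{-1},2t^{-2}\}}{6\lambda} + \frac{\mathbb{E}\left\{D^2\,\mathbb{I}[|W-t|\le |D|]\right\}}{\lambda t}.$$
   Context: $\mathbb{I}[A]$ is the indicator function of the event $A$. $\mathbb{E}(\cdot|W)$ is conditional expectation given $W$. Expectations of non-negative random variables take values in $[0,\infty]$, so the bound is trivial when its right-hand side is infinite. *)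

(* Defs.v *)
From HB Require Import structures.
From mathcomp Require Import all_boot all_order all_algebra.
From mathcomp Require Import all_classical all_reals all_analysis measurable_realfun.

Set Implicit Arguments.
Unset Strict Implicit.
Unset Printing Implicit Defensive.

Import Order.TTheory GRing.Theory Num.Theory.
Import numFieldNormedType.Exports.

Local Open Scope classical_set_scope.
Local Open Scope ring_scope.
Local Open Scope ereal_scope.

(* [is_cond_exp W X Y]: Y is a version of the conditional expectation
   E(X | W), i.e. of E(X | sigma(W)).  Conditional expectation is defined for
   nonnegative X, with values in [0, +oo] and no integrability condition, and
   for integrable X; these are the two alternatives of the first clause. *)
Definition is_cond_exp d (T : measurableType d) (R : realType)
    (P : probability T R) (W : {RV P >-> R}) (X Y : T -> \bar R) : Prop :=
  [/\ (forall w, 0 <= X w /\ 0 <= Y w) \/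
      (P.-integrable [set: T] X /\ P.-integrable [set: T] Y),
      measurable_fun [set: g_sigma_algebra_preimageType W] Y &
      forall A : set T, g_sigma_algebra_preimage W A ->
        \int[P]_(w in A) Y w = \int[P]_(w in A) X w].

(* Measures are functions on all sets, constrained only on measurable ones,
   so equality of laws is equality on measurable sets. *)
Definition same_law d d' (T : measurableType d) (T' : measurableType d')
    (R : realType) (P : probability T R) (P' : probability T' R)
    (X : {RV P >-> R}) (X' : {RV P' >-> R}) : Prop :=
  forall B : set R, measurable B -> distribution P X B = distribution P' X' B.

(* The exponential law of rate r has mean 1 / r. *)
Definition exponential_mean1 d (T : measurableType d) (R : realType)
    (P : probability T R) (Z : {RV P >-> R}) : Prop :=
  forall B : set R, measurable B -> distribution P Z B = exponential_prob 1%R B.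

(* Main.v *)
(* Stein's method.  For [h x = 1] if [x <= t] and [0] otherwise, the equation
   [x f' x - (x - 1) f x = h x - (1 - exp (- t))] is solved by
   [f x = exp (- t) (exp x - 1) / x] for [x <= t] and
   [f x = (1 - exp (- t)) / x] for [x > t].  Since [W] and [W'] have the same
   law, an antiderivative [F] of [f] has [E (F W' - F W) = 0].  Expanding [F] to
   second order around [W] and conditioning on [W] turns this into
     2 lambda (P (W <= t) - P (Z <= t))
       = E ((2 lambda W - E (D^2 | W)) f' W) - 2 E (remainder).
   Here [|f'| <= 1 / t], and the remainder is at most [max (1 / t) (2 / t^2) |D|^3 / 6]
   unless [t] lies between [W] and [W'], where [f'] jumps; in that case it is
   at most [D^2 / t] because [f] is Lipschitz with constant [1 / t]. *)
Require Import Defs.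
From HB Require Import structures.
From mathcomp Require Import all_boot all_order all_algebra.
From mathcomp Require Import all_classical all_reals all_analysis measurable_realfun.
From mathcomp Require Import ring lra.

Set Implicit Arguments.
Unset Strict Implicit.
Unset Printing Implicit Defensive.

Import Order.TTheory GRing.Theory Num.Theory.
Import numFieldNormedType.Exports.

Local Open Scope classical_set_scope.
Local Open Scope ring_scope.

(** * Entire power series dominated by the exponential series *)

Section exponentially_bounded_series.
Context {R : realType}.
Implicit Types (c : nat -> R) (x y : R).

(** The upper bound gives convergence on the whole line and survives termwise differentiation; the
    sign makes the sum nonnegative and nondecreasing on nonnegative reals. *)
Definition exp_bounded c := forall n, 0 <= c n <= (n`!%:R)^-1.

Definition psum c x : R := limn (pseries c x).

(** The factor [n + 1] brought down by differentiation turns [1 / (n + 1)!] into [1 / n!]. *)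
Lemma exp_bounded_diffs c : exp_bounded c -> exp_bounded (pseries_diffs c).
Proof.
move=> hc n; have /andP[c0 c1] := hc n.+1.
rewrite /pseries_diffs mulr_ge0//=.
apply: (le_trans (ler_wpM2l _ c1)) => //.
by rewrite factS natrM invfM mulVKf.
Qed.

Lemma is_cvg_psum c x : exp_bounded c -> cvgn (pseries c x).
Proof.
move=> hc; apply: normed_cvg; rewrite /normed_series_of/=.
apply: (@series_le_cvg _ _ (exp_coeff `|x|)) => [n|n|n|].
- exact: normr_ge0.
- exact: exp_coeff_ge0.
- have /andP[c0 c1] := hc n.
  rewrite normrM normrX ger0_norm// exp_coeffE.
  by rewrite ler_wpM2r// exprn_ge0.
- exact: is_cvg_series_exp_coeff.
Qed.

Lemma is_derive_psum c x : exp_bounded c ->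
  is_derive x 1 (psum c) (psum (pseries_diffs c) x).
Proof.
(* Termwise differentiation at [x] asks for convergence of the series and of its first two formal
   derivatives at some point strictly beyond [|x|]; [|x| + 1] is one. *)
move=> hc; apply: (@pseries_snd_diffs _ _ (`|x| + 1)).
- exact: is_cvg_psum.
- exact/is_cvg_psum/exp_bounded_diffs.
- exact/is_cvg_psum/exp_bounded_diffs/exp_bounded_diffs.
- by rewrite [ltRHS]ger0_norm ?ltrDl ?addr_ge0.
Qed.

Lemma psum_ge0 c x : exp_bounded c -> 0 <= x -> 0 <= psum c x.
Proof.
move=> hc x0; apply: limr_ge; first exact: is_cvg_psum.
apply: nearW => n; rewrite /pseries/series/=.
by apply: sumr_ge0 => i _; have /andP[? _] := hc i; rewrite mulr_ge0// exprn_ge0.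
Qed.

Lemma psum_le c x y : exp_bounded c -> 0 <= x -> x <= y -> psum c x <= psum c y.
Proof.
move=> hc x0 xy; apply: ler_lim; [exact: is_cvg_psum|exact: is_cvg_psum|].
apply: nearW => n; rewrite /pseries/series/=.
apply: ler_sum => i _; have /andP[? _] := hc i.
by rewrite ler_wpM2l// lerXn2r ?nnegrE// (le_trans x0).
Qed.

(** Multiplying by [x] shifts the series to that of [exp] without its constant term. The sum is thus
    [(exp x - 1) / x] with the singularity at [0] removed. *)
Lemma psum_expR x :
  x * psum (fun n => (n.+1`!%:R)^-1) x = expR x - 1.
Proof.
have hc : exp_bounded (fun n => (n.+1`!%:R)^-1).
  move=> n; rewrite invr_ge0 ler0n/= lef_pV2 ?posrE ?ltr0n ?fact_gt0//.
  by rewrite ler_nat factS leq_pmull.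
have h1 : (x * pseries (fun n => (n.+1`!%:R)^-1) x n @[n --> \oo] -->
    x * psum (fun n => (n.+1`!%:R)^-1) x).
  by apply: cvgMl_tmp; exact: is_cvg_psum.
have h2 : ((series (exp_coeff x) n.+1 - 1) @[n --> \oo] --> expR x - 1).
  apply: cvgB; last exact: cvg_cst.
  by rewrite (cvg_shiftS (series (exp_coeff x))); exact: is_cvg_series_exp_coeff.
apply: (cvg_unique _ h1) => //.
rewrite (_ : (fun n => _) = (fun n => series (exp_coeff x) n.+1 - 1))//.
apply/funext => n; rewrite /pseries/series/= big_nat_recl//=.
rewrite /exp_coeff/= expr0 fact0 divr1 addrAC subrr add0r mulr_sumr.
by apply: eq_bigr => i _; rewrite exprS -mulrA [X in _ * X = _]mulrC.
Qed.

End exponentially_bounded_series.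

(** * Taylor remainders along a segment, obtained without integrals *)

Section taylor.
Context {R : realType}.
Implicit Types (u v phi : R -> R) (x y a b : R).

Lemma is_derive_lincomb (f g : R -> R) (df dg k x : R) :
  is_derive x 1 f df -> is_derive x 1 g dg ->
  is_derive x 1 (fun s => f s + k * g s) (df + k * dg).
Proof. by move=> ? ?; exact: (is_deriveD (f := f) (g := k \*: g)). Qed.

Lemma is_derive_affine_comp (f : R -> R) (df x h s : R) :
  is_derive (x + s * h) 1 f df ->
  is_derive s 1 (fun s => f (x + s * h)) (h * df).
Proof.
move=> fdf; rewrite mulrC; apply: (is_derive1_comp (f := f)) => //.
by apply: is_derive_eq; rewrite /GRing.scale/=; ring.
Qed.

Lemma is_derive_within_continuous (u u' : R -> R) a b :
  (forall s : R, s \in `[a, b] -> is_derive s 1 u (u' s)) ->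
  {within `[a, b], continuous u}.
Proof.
move=> du; apply: derivable_within_continuous => s sab.
by have [] := du s sab.
Qed.

(** The mean value theorem applied to [v - u] and [v + u], which vanish at [0] and have nonnegative
    derivatives. It replaces integration of the inequality [|u'| <= v']. *)
Lemma dominated_by_derive (u u' v v' : R -> R) :
  (forall s : R, s \in `[0, 1] -> is_derive s 1 u (u' s)) ->
  (forall s : R, s \in `[0, 1] -> is_derive s 1 v (v' s)) ->
  u 0 = 0 -> v 0 = 0 ->
  (forall s : R, s \in `[0, 1] -> `|u' s| <= v' s) ->
  forall s : R, s \in `[0, 1] -> `|u s| <= v s.
Proof.
move=> du dv u0 v0 uv s; rewrite in_itv/= => /andP[s0 s1].
have sub (r : R) : r \in `[0, s] -> r \in `[0, 1].
  by rewrite !in_itv/= => /andP[-> /le_trans -> ].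
have sub' (r : R) : r \in `]0, s[ -> r \in `[0, 1].
  by move=> rs; apply: sub; exact: subset_itv_oo_cc.
have key (e : R) : `|e| = 1 -> 0 <= v s + - e * u s.
  move=> e1.
  have dw (r : R) : r \in `[0, 1] ->
      is_derive r 1 (fun r => v r + - e * u r) (v' r + - e * u' r).
    by move=> r01; apply: is_derive_lincomb; [exact: dv|exact: du].
  have := @MVT_segment R (fun r => v r + - e * u r) (fun r => v' r + - e * u' r) 0 s s0
    (fun r rs => dw r (sub' r rs))
    (@is_derive_within_continuous _ _ 0 s (fun r rs => dw r (sub r rs))).
  move=> [r rs]; rewrite u0 v0 mulr0 addr0 !subr0 => ->.
  rewrite mulr_ge0// mulNr subr_ge0 (le_trans _ (uv r (sub r rs)))//.
  by rewrite (le_trans (ler_norm _))// normrM e1 mul1r.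
have := key 1 (normr1 _); have := key (-1) (normrN1 _).
by rewrite opprK mulN1r mul1r subr_ge0 ler_norml => ? ->; rewrite andbT; lra.
Qed.

(** Parametrizing the segment by [s] in [[0, 1]] treats both signs of [h] at once and asks for
    derivatives on the segment only, as needed for functions such as [ln]. *)
Lemma derive_bounded_lipschitz phi (phi1 : R -> R) K x h :
  (forall s : R, s \in `[0, 1] -> is_derive (x + s * h) 1 phi (phi1 (x + s * h))) ->
  (forall s : R, s \in `[0, 1] -> `|phi1 (x + s * h)| <= K) ->
  `|phi (x + h) - phi x| <= K * `|h|.
Proof.
move=> d1 bnd.
have one01 : (1 : R) \in `[0, 1] by rewrite in_itv/= ler01 lexx.
suff /(_ 1 one01) : forall s : R, s \in `[0, 1] ->
    `|phi (x + s * h) - phi x| <= K * `|h| * s.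
  by rewrite mul1r mulr1.
apply: (@dominated_by_derive (fun s => phi (x + s * h) - phi x)
  (fun s => h * phi1 (x + s * h)) (fun s => K * `|h| * s) (fun=> K * `|h|)).
- move=> r r01; have ? := is_derive_affine_comp (d1 r r01).
  by apply: is_derive_eq; rewrite subr0.
- move=> r r01; apply: is_derive_eq.
  by rewrite /GRing.scale/=; ring.
- by rewrite mul0r addr0 subrr.
- by rewrite mulr0.
- by move=> r r01; rewrite normrM mulrC ler_wpM2r// bnd.
Qed.

(** As a function of [s], the remainder has derivative [h (phi1 (x + s h) - phi1 x)], at most
    [K h^2 s] by the Lipschitz bound, and this is the derivative of [K h^2 s^2 / 2]. *)
Lemma taylor1 phi (phi1 phi2 : R -> R) K x h :
  (forall s : R, s \in `[0, 1] -> is_derive (x + s * h) 1 phi (phi1 (x + s * h))) ->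
  (forall s : R, s \in `[0, 1] -> is_derive (x + s * h) 1 phi1 (phi2 (x + s * h))) ->
  (forall s : R, s \in `[0, 1] -> `|phi2 (x + s * h)| <= K) ->
  `|phi (x + h) - phi x - h * phi1 x| <= K * h ^+ 2 / 2.
Proof.
move=> d0 d1 bnd.
have one01 : (1 : R) \in `[0, 1] by rewrite in_itv/= ler01 lexx.
(* The segment from [x] to [x + s * h] is part of the given one, so the previous bound applies with
   increment [s * h]. *)
have step1 (s : R) : s \in `[0, 1] ->
    `|phi1 (x + s * h) - phi1 x| <= K * `|h| * s.
  move=> s01; have /andP[s0 _] : 0 <= s <= 1 by move: s01; rewrite in_itv.
  have sub (r : R) : r \in `[0, 1] -> r * s \in `[0, 1].
    by move: s01; rewrite !in_itv/=; nra.
  rewrite -mulrA -[X in _ * (_ * X)]ger0_norm// -normrM [h * s]mulrC.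
  by apply: (derive_bounded_lipschitz (phi1 := phi2)) => r r01;
    rewrite mulrA; [apply: d1|apply: bnd]; exact: sub.
suff /(_ 1 one01) : forall s : R, s \in `[0, 1] ->
    `|phi (x + s * h) - phi x + - (h * phi1 x) * s| <= K * h ^+ 2 / 2 * s ^+ 2.
  by rewrite mul1r expr1n !mulr1.
apply: (@dominated_by_derive
  (fun s => phi (x + s * h) - phi x + - (h * phi1 x) * s)
  (fun s => h * phi1 (x + s * h) + - (h * phi1 x) * 1)
  (fun s => K * h ^+ 2 / 2 * s ^+ 2) (fun s => K * h ^+ 2 * s)).
- move=> r r01; have ? := is_derive_affine_comp (d0 r r01).
  apply: is_derive_lincomb; apply: is_derive_eq.
  by rewrite subr0.
- move=> r r01; apply: is_derive_eq.
  by rewrite /GRing.scale/=; field.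
- by rewrite mul0r addr0 subrr mulr0 addr0.
- by rewrite expr0n mulr0.
- move=> r r01; rewrite mulr1 -mulrBr normrM.
  apply: (le_trans (ler_wpM2l _ (step1 r r01))) => //.
  by rewrite -(@real_normK _ h) ?num_real//; lra.
Qed.

(** One order higher by the same argument: the derivative of the remainder in [s] is [h] times the
    first-order remainder of [phi1]. *)
Lemma taylor2 phi (phi1 phi2 phi3 : R -> R) K x h :
  (forall s : R, s \in `[0, 1] -> is_derive (x + s * h) 1 phi (phi1 (x + s * h))) ->
  (forall s : R, s \in `[0, 1] -> is_derive (x + s * h) 1 phi1 (phi2 (x + s * h))) ->
  (forall s : R, s \in `[0, 1] -> is_derive (x + s * h) 1 phi2 (phi3 (x + s * h))) ->
  (forall s : R, s \in `[0, 1] -> `|phi3 (x + s * h)| <= K) ->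
  `|phi (x + h) - phi x - h * phi1 x - h ^+ 2 / 2 * phi2 x| <= K * `|h| ^+ 3 / 6.
Proof.
move=> d0 d1 d2 bnd.
have one01 : (1 : R) \in `[0, 1] by rewrite in_itv/= ler01 lexx.
have step1 (s : R) : s \in `[0, 1] ->
    `|phi1 (x + s * h) - phi1 x - s * h * phi2 x| <= K * (s * h) ^+ 2 / 2.
  move=> s01.
  have sub (r : R) : r \in `[0, 1] -> r * s \in `[0, 1].
    by move: s01; rewrite !in_itv/=; nra.
  by apply: (taylor1 (phi2 := phi3)) => r r01;
    rewrite mulrA; [apply: d1|apply: d2|apply: bnd]; exact: sub.
suff /(_ 1 one01) : forall s : R, s \in `[0, 1] ->
    `|phi (x + s * h) - phi x + - (h * phi1 x) * s
      + - (h ^+ 2 / 2 * phi2 x) * s ^+ 2| <= K * `|h| ^+ 3 / 6 * s ^+ 3.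
  by rewrite mul1r !expr1n !mulr1.
apply: (@dominated_by_derive
  (fun s => phi (x + s * h) - phi x + - (h * phi1 x) * s
            + - (h ^+ 2 / 2 * phi2 x) * s ^+ 2)
  (fun s => h * phi1 (x + s * h) + - (h * phi1 x) * 1
            + - (h ^+ 2 / 2 * phi2 x) * (2 * s))
  (fun s => K * `|h| ^+ 3 / 6 * s ^+ 3) (fun s => K * `|h| ^+ 3 / 2 * s ^+ 2)).
- move=> r r01; have ? := is_derive_affine_comp (d0 r r01).
  apply: is_derive_lincomb; last first.
    by apply: is_derive_eq; rewrite /GRing.scale/=; ring.
  apply: is_derive_lincomb; apply: is_derive_eq.
  by rewrite subr0.
- move=> r r01; apply: is_derive_eq.
  by rewrite /GRing.scale/=; field.
- by rewrite mul0r addr0 subrr mulr0 expr0n mulr0 !addr0.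
- by rewrite expr0n mulr0.
- move=> r r01.
  rewrite (_ : _ + _ = h * (phi1 (x + r * h) - phi1 x - r * h * phi2 x)); last by field.
  rewrite normrM.
  apply: (le_trans (ler_wpM2l _ (step1 r r01))) => //.
  by rewrite exprMn -(@real_normK _ h) ?num_real//; lra.
Qed.

Lemma segment_ge x y b (s : R) :
  b <= x -> b <= y -> s \in `[0, 1] -> b <= x + s * (y - x).
Proof.
rewrite in_itv/= => bx by_ /andP[s0 s1].
have := mulr_ge0 s0 (etrans (subr_ge0 _ _) by_).
have := mulr_ge0 (etrans (subr_ge0 _ _) s1) (etrans (subr_ge0 _ _) bx).
lra.
Qed.

Lemma segment_le x y b (s : R) :
  x <= b -> y <= b -> s \in `[0, 1] -> x + s * (y - x) <= b.
Proof.
rewrite in_itv/= => xb yb /andP[s0 s1].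
have := mulr_ge0 s0 (etrans (subr_ge0 _ _) yb).
have := mulr_ge0 (etrans (subr_ge0 _ _) s1) (etrans (subr_ge0 _ _) xb).
lra.
Qed.

(* Only first-order expansions are used, on each side of the junction [b]: the
   second derivatives of the two pieces need not agree at [b]. *)
Lemma taylor2_crossing phi (phi1 phi2 : R -> R) psi (psi1 psi2 : R -> R) K x b y :
  0 <= (y - b) * (b - x) ->
  (forall s : R, s \in `[0, 1] ->
    let z := x + s * (b - x) in
    [/\ is_derive z 1 phi (phi1 z), is_derive z 1 phi1 (phi2 z) & `|phi2 z| <= K]) ->
  (forall s : R, s \in `[0, 1] ->
    let z := b + s * (y - b) in
    [/\ is_derive z 1 psi (psi1 z), is_derive z 1 psi1 (psi2 z) & `|psi2 z| <= K]) ->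
  phi b = psi b -> phi1 b = psi1 b ->
  `|psi y - phi x - (y - x) * phi1 x - (y - x) ^+ 2 / 2 * phi2 x| <= K * (y - x) ^+ 2.
Proof.
move=> uv hphi hpsi e0 e1.
have K0 : 0 <= K.
  have [|_ _] := hphi 0; first by rewrite in_itv/= lexx ler01.
  by apply: le_trans.
have T1 : `|phi (x + (b - x)) - phi x - (b - x) * phi1 x| <= K * (b - x) ^+ 2 / 2.
  apply: (@taylor1 phi phi1 phi2) => s s01; have [d0 d1 d2] := hphi s s01;
    [exact: d0|exact: d1|exact: d2].
have T2 : `|phi1 (x + (b - x)) - phi1 x| <= K * `|b - x|.
  apply: (@derive_bounded_lipschitz phi1 phi2) => s s01;
    have [_ d1 d2] := hphi s s01; [exact: d1|exact: d2].
have T3 : `|psi (b + (y - b)) - psi b - (y - b) * psi1 b| <= K * (y - b) ^+ 2 / 2.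
  apply: (@taylor1 psi psi1 psi2) => s s01; have [d0 d1 d2] := hpsi s s01;
    [exact: d0|exact: d1|exact: d2].
have T4 : `|phi2 x| <= K.
  have [|_ _] := hphi 0; first by rewrite in_itv/= lexx ler01.
  by rewrite mul0r addr0.
rewrite [x + _]addrC subrK in T1 T2; rewrite [b + _]addrC subrK in T3.
have T2' : `|(y - b) * (phi1 b - phi1 x)| <= K * ((y - b) * (b - x)).
  rewrite normrM (le_trans (ler_wpM2l (normr_ge0 _) T2))//.
  by rewrite mulrCA -normrM ger0_norm.
have T4' : `|(y - x) ^+ 2 / 2 * phi2 x| <= (y - x) ^+ 2 / 2 * K.
  by rewrite normrM ger0_norm ?divr_ge0 ?sqr_ge0// ler_wpM2l// divr_ge0// sqr_ge0.
(* The quantity splits into the two first-order remainders, the cross term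
   [(y - b) (phi1 b - phi1 x)] and the quadratic term at [x]. The first three sum to at most
   [K / 2 * ((y - b) + (b - x))^2], the last is at most [K / 2 * (y - x)^2]. *)
move: T1 T2' T3 T4'; rewrite !ler_norml -e0 -e1.
move=> /andP[? ?] /andP[? ?] /andP[? ?] /andP[? ?].
by apply/andP; split; lra.
Qed.

End taylor.

Lemma measurable_inv {R : realType} : measurable_fun [set: R] (@GRing.inv R).
Proof.
(* The inverse is the power [-1] on nonnegative reals, with the same default value [0] at [0], and
   is extended to negative reals by oddness. *)
rewrite (_ : GRing.inv = fun x : R => if 0 <= x then x `^ (-1) else - ((- x) `^ (-1))).
  apply: measurable_fun_ifT; first exact: measurable_fun_ler.
    exact: measurable_powR.
  by apply: measurable_funN; apply: (measurableT_comp (measurable_powR _)).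
apply/funext => x; case: ifPn => [x0|]; first by rewrite powR_inv1.
by rewrite -ltNge => x0; rewrite powR_inv1 ?oppr_ge0 ?ltW// invrN opprK.
Qed.

(** * The Stein equation of the exponential law and its solution *)

Section stein_equation.
Context {R : realType}.
Implicit Types x y t : R.

(* The antiderivative of [(exp x - 1) / x] vanishing at [0] has coefficients
   [1 / (n * n!)]; at [n = 0] Rocq's division gives [0]. *)
Let c (n : nat) : R := (n%:R)^-1 / n`!%:R.

Let c_bounded : exp_bounded c.
Proof.
case=> [|n]; rewrite /c; first by rewrite invr0 mul0r lexx/=.
rewrite mulr_ge0 ?invr_ge0//= -[leRHS]mul1r ler_wpM2r ?invr_ge0//.
by rewrite invf_le1// ler1n.
Qed.

Let G := psum c.
(** [g] is [(exp x - 1) / x], and [g1], [g2] are its first two derivatives. As series with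
    nonnegative coefficients all three are nondecreasing on [[0, +oo)]. *)
Let g := psum (pseries_diffs c).
Let g1 := psum (pseries_diffs (pseries_diffs c)).
Let g2 := psum (pseries_diffs (pseries_diffs (pseries_diffs c))).

Let b1 := exp_bounded_diffs c_bounded.
Let b2 := exp_bounded_diffs b1.
Let b3 := exp_bounded_diffs b2.

Let dG x : is_derive x 1 G (g x).
Proof. exact: is_derive_psum. Qed.

Let dg x : is_derive x 1 g (g1 x).
Proof. exact: is_derive_psum. Qed.

Let dg1 x : is_derive x 1 g1 (g2 x).
Proof. exact: is_derive_psum. Qed.

Let gE x : x * g x = expR x - 1.
Proof.
rewrite -psum_expR /g; congr (_ * psum _ x); apply/funext => n.
by rewrite /pseries_diffs /c mulrA mulfV ?mul1r// pnatr_eq0.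
Qed.

(** Both sides of [x g x = exp x - 1] are differentiated and compared; [g2E] repeats this on the
    present identity. *)
Let g1E x : x * g1 x = expR x - g x.
Proof.
have dgx := dg x.
have d1 : is_derive x 1 (fun y => y * g y) (g x + x * g1 x).
  by apply: is_derive_eq; rewrite /GRing.scale/=; ring.
have d2 : is_derive x 1 (fun y => y * g y) (expR x).
  rewrite (_ : (fun y => _) = (fun y => expR y - 1)); last exact/funext/gE.
  by apply: is_derive_eq; rewrite subr0.
have := @derive_val _ _ _ _ _ _ _ d1; rewrite derive_val => ->.
by rewrite addrAC subrr add0r.
Qed.

Let g2E x : x * g2 x = expR x - 2 * g1 x.
Proof.
have dgx := dg x; have dg1x := dg1 x.
have d1 : is_derive x 1 (fun y => y * g1 y) (g1 x + x * g2 x).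
  by apply: is_derive_eq; rewrite /GRing.scale/=; ring.
have d2 : is_derive x 1 (fun y => y * g1 y) (expR x - g1 x).
  rewrite (_ : (fun y => _) = (fun y => expR y - g y)); last exact/funext/g1E.
  by apply: is_derive_eq.
have : expR x - g1 x = g1 x + x * g2 x.
  by rewrite -(@derive_val _ _ _ _ _ _ _ d1) -(@derive_val _ _ _ _ _ _ _ d2).
by lra.
Qed.

Let measurable_of_derive (u u' : R -> R) :
  (forall x, is_derive x 1 u (u' x)) -> measurable_fun setT u.
Proof.
move=> du; apply: continuous_measurable_fun => x.
by apply/differentiable_continuous/derivable1_diffP; have [] := du x.
Qed.

Let mG : measurable_fun setT G. Proof. exact: measurable_of_derive dG. Qed.
Let mg : measurable_fun setT g. Proof. exact: measurable_of_derive dg. Qed.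
Let mg1 : measurable_fun setT g1. Proof. exact: measurable_of_derive dg1. Qed.

Section fixed_level.
Variable t : R.
Hypothesis t0 : 0 < t.

Let a := expR (- t).

Let a_gt0 : 0 < a. Proof. exact: expR_gt0. Qed.

Let a_le1 : a <= 1.
Proof. by rewrite /a -expR0 ler_expR oppr_le0 ltW. Qed.

(** This cancels one power of [t] in the bounds on [B2] and [B3], where the numerator [1 - a] would
    otherwise leave [1 / t^2] and [2 / t^3]. *)
Let a_ge1Bt : 1 - a <= t.
Proof. by have := expR_ge1Dx (- t); rewrite -/a; lra. Qed.

Let aK : a * expR t = 1.
Proof. by rewrite /a -expRD addNr expR0. Qed.

(** [A] is the antiderivative of the solution on [[0, t]], and [A1], [A2], [A3] are its derivatives.
    Subtracting [G 0] gives [A 0 = 0] without evaluating the series. *)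
Let A x := a * (G x - G 0).
Let A1 x := a * g x.
Let A2 x := a * g1 x.
Let A3 x := a * g2 x.

(** [B] continues the antiderivative beyond [t]; the constant [A t] makes the two pieces agree at
    [t]. *)
Let B x := A t + (1 - a) * (ln x - ln t).
Let B1 x := (1 - a) / x.
Let B2 x := - ((1 - a) / x ^+ 2).
Let B3 x := 2 * (1 - a) / x ^+ 3.

Let dA x : is_derive x 1 A (A1 x).
Proof.
by have ? := dG x; apply: is_derive_eq; rewrite /GRing.scale/= /A1; ring.
Qed.

Let dA1 x : is_derive x 1 A1 (A2 x).
Proof.
by have ? := dg x; apply: is_derive_eq; rewrite /GRing.scale/= /A2; ring.
Qed.

Let dA2 x : is_derive x 1 A2 (A3 x).
Proof.
by have ? := dg1 x; apply: is_derive_eq; rewrite /GRing.scale/= /A3; ring.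
Qed.

Let dB x : 0 < x -> is_derive x 1 B (B1 x).
Proof.
move=> x0; have ? := is_derive1_ln x0; apply: is_derive_eq.
by rewrite /GRing.scale/= /B1; ring.
Qed.

Let dB1 x : 0 < x -> is_derive x 1 B1 (B2 x).
Proof.
move=> x0; have x0' : x != 0 by rewrite gt_eqF.
have ? := @is_deriveV _ id x 1 1 x0' (is_derive_id x 1).
apply: is_derive_eq; rewrite /GRing.scale/= /B2.
by field.
Qed.

Let dB2 x : 0 < x -> is_derive x 1 B2 (B3 x).
Proof.
move=> x0; have x0' : x != 0 by rewrite gt_eqF.
have d2 : is_derive x 1 (fun y : R => y ^+ 2) (2 * x).
  by apply: is_derive_eq; rewrite /GRing.scale/=; ring.
have ? := @is_deriveV _ (fun y : R => y ^+ 2) x (2 * x) 1 (expf_neq0 2 x0') d2.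
apply: is_derive_eq; rewrite /GRing.scale/= /B3.
by field.
Qed.

Let A1_bnd x : 0 <= x -> x <= t -> 0 <= A1 x <= t^-1.
Proof.
move=> x0 xt; rewrite mulr_ge0 ?psum_ge0 ?(ltW a_gt0)//=.
apply: (@le_trans _ _ (a * g t)); first by rewrite ler_wpM2l ?psum_le ?(ltW a_gt0).
by rewrite -[leRHS]mul1r ler_pdivlMr// -mulrA [g t * t]mulrC gE mulrBr aK; have := a_gt0; lra.
Qed.

Let A2_bnd x : 0 <= x -> x <= t -> 0 <= A2 x <= t^-1.
Proof.
move=> x0 xt; rewrite mulr_ge0 ?psum_ge0 ?(ltW a_gt0)//=.
apply: (@le_trans _ _ (a * g1 t)); first by rewrite ler_wpM2l ?psum_le ?(ltW a_gt0).
rewrite -[leRHS]mul1r ler_pdivlMr// -mulrA [g1 t * t]mulrC g1E mulrBr aK.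
by rewrite gerBl mulr_ge0 ?psum_ge0 ?(ltW a_gt0) ?(ltW t0).
Qed.

Let A3_bnd x : 0 <= x -> x <= t -> 0 <= A3 x <= t^-1.
Proof.
move=> x0 xt; rewrite mulr_ge0 ?psum_ge0 ?(ltW a_gt0)//=.
apply: (@le_trans _ _ (a * g2 t)); first by rewrite ler_wpM2l ?psum_le ?(ltW a_gt0).
rewrite -[leRHS]mul1r ler_pdivlMr// -mulrA [g2 t * t]mulrC g2E mulrBr aK.
by rewrite gerBl mulr_ge0 ?mulr_ge0 ?psum_ge0 ?(ltW a_gt0) ?(ltW t0).
Qed.

Let A1_abs x : 0 <= x -> x <= t -> `|A1 x| <= t^-1.
Proof. by move=> x0 xt; have /andP[? ?] := A1_bnd x0 xt; rewrite ger0_norm. Qed.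

Let A2_abs x : 0 <= x -> x <= t -> `|A2 x| <= t^-1.
Proof. by move=> x0 xt; have /andP[? ?] := A2_bnd x0 xt; rewrite ger0_norm. Qed.

Let A3_abs x : 0 <= x -> x <= t -> `|A3 x| <= t^-1.
Proof. by move=> x0 xt; have /andP[? ?] := A3_bnd x0 xt; rewrite ger0_norm. Qed.

Let A0 : A 0 = 0. Proof. by rewrite /A subrr mulr0. Qed.

Let Bt : B t = A t. Proof. by rewrite /B subrr mulr0 addr0. Qed.

(** With [Bt], this is the matching of values and slopes that the crossing expansion requires. The
    next derivatives differ: [A2 t - B2 t = 1 / t], from the unit jump of the indicator. *)
Let B1t : A1 t = B1 t.
Proof.
have t0' : t != 0 by rewrite gt_eqF.
apply: (mulfI t0'); rewrite /A1 /B1 mulrCA gE mulrBr aK mulr1 mulrCA mulfV//.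
by rewrite mulr1.
Qed.

Let B1_bnd x : t <= x -> 0 <= B1 x <= t^-1.
Proof.
move=> tx; have x0 := lt_le_trans t0 tx.
rewrite divr_ge0 ?subr_ge0 ?(ltW x0)//=.
rewrite ler_pdivrMr// mulrC ler_pdivlMr//.
by have := mulr_gt0 a_gt0 t0; lra.
Qed.

Let B2_bnd x : t <= x -> `|B2 x| <= t^-1.
Proof.
move=> tx; have x0 := lt_le_trans t0 tx.
rewrite normrN ger0_norm ?divr_ge0 ?subr_ge0 ?exprn_ge0 ?(ltW x0)//.
rewrite ler_pdivrMr ?exprn_gt0// mulrC ler_pdivlMr//.
apply: (@le_trans _ _ (t ^+ 2)); first by rewrite expr2 ler_pM2r.
by rewrite lerXn2r ?nnegrE// ltW.
Qed.

Let B3_bnd x : t <= x -> `|B3 x| <= 2 * t ^- 2.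
Proof.
move=> tx; have x0 := lt_le_trans t0 tx.
rewrite ger0_norm ?divr_ge0 ?mulr_ge0 ?subr_ge0 ?exprn_ge0 ?(ltW x0)//.
have le3 : (1 - a) * t ^+ 2 <= x ^+ 3.
  apply: (@le_trans _ _ (t ^+ 3)); last by rewrite lerXn2r ?nnegrE// ltW.
  by rewrite [leRHS]exprS ler_wpM2r// exprn_ge0// ltW.
by rewrite ler_pdivrMr ?exprn_gt0// mulrAC ler_pdivlMr ?exprn_gt0// -!mulrA ler_pM2l.
Qed.

(* For [x <= t], [x f = a (exp x - 1)] with [a = exp (- t)], and differentiating
   gives [x f' = a exp x - f] and [x f'' = a exp x - 2 f']; as [f'] and [f'']
   are nonnegative and nondecreasing there, evaluating at [t], where
   [a exp t = 1], bounds both by [1 / t]. *)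
Lemma exponential_stein_solution : exists F f f' : R -> R,
  [/\ [/\ measurable_fun setT F, measurable_fun setT f & measurable_fun setT f'],
      (forall x, 0 <= x ->
        x * f' x - (x - 1) * f x = (x <= t)%R%:R - (1 - expR (- t))),
      (forall x, 0 <= x ->
        [/\ `|F x| <= t^-1 * x, `|f x| <= t^-1 & `|f' x| <= t^-1]) &
      forall x y, 0 <= x -> 0 <= y ->
        `|F y - F x - (y - x) * f x - (y - x) ^+ 2 / 2 * f' x| <=
        Num.max t^-1 (2 * t ^- 2) * `|y - x| ^+ 3 / 6
        + (y - x) ^+ 2 / t * (`|x - t| <= `|y - x|)%R%:R].
Proof.
have t0' : t != 0 by rewrite gt_eqF.
have mle : measurable_fun setT (fun x => x <= t).
  by apply: measurable_fun_ler => //; exact: measurable_cst.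
exists (fun x => if x <= t then A x else B x),
  (fun x => if x <= t then A1 x else B1 x),
  (fun x => if x <= t then A2 x else B2 x); split.
- split; apply: measurable_fun_ifT => //.
  + by apply: measurable_funM => //; apply: measurable_funB.
  + apply: measurable_funD => //; apply: measurable_funM => //.
    by apply: measurable_funB => //; exact: measurable_ln.
  + by apply: measurable_funM.
  + by apply: measurable_funM => //; exact: measurable_inv.
  + by apply: measurable_funM.
  + apply: measurable_funN; apply: measurable_funM => //.
    apply: (measurableT_comp measurable_inv); exact: exprn_measurable.
(* Both sides equal [a] when [x <= t], and [a - 1] beyond [t]. *)
- move=> x x0; case: ifPn => [xt|]/=.
    rewrite /A1 /A2.
    have -> : x * (a * g1 x) - (x - 1) * (a * g x) =
      a * (x * g1 x - (x * g x - g x)) by ring.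
    by rewrite g1E gE -/a; ring.
  rewrite -ltNge => tx; rewrite /B1 /B2 -/a.
  by have x0' : x != 0; [rewrite gt_eqF// (lt_trans t0)|field].
- move=> x x0.
  have FA r : 0 <= r -> r <= t -> `|A r| <= t^-1 * r.
    move=> r0 rt; have := @derive_bounded_lipschitz _ A A1 t^-1 0 (r - 0).
    rewrite [0 + _]addrC subrK A0 !subr0 (ger0_norm r0); apply.
      by move=> s _; exact: dA.
    move=> s s01; rewrite -[r]subr0.
    by apply: A1_abs; [exact: segment_ge|apply: segment_le => //; exact: ltW].
  case: ifPn => [xt|].
    by split; [exact: FA|exact: A1_abs|exact: A2_abs].
  rewrite -ltNge => /ltW tx.
  split; [|by have /andP[? ?] := B1_bnd tx; rewrite ger0_norm|exact: B2_bnd].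
  (* Beyond [t], the Lipschitz bound starts from [t]: [|B x| <= |A t| + (x - t) / t <= x / t]. *)
  have := @derive_bounded_lipschitz _ B B1 t^-1 t (x - t).
  rewrite [t + _]addrC subrK (ger0_norm (etrans (subr_ge0 _ _) tx)) Bt => BA.
  have /BA {}BA : forall s : R, s \in `[0, 1] ->
      is_derive (t + s * (x - t)) 1 B (B1 (t + s * (x - t))).
    by move=> s s01; apply: dB; apply: (lt_le_trans t0); exact: segment_ge.
  have /BA {}BA : forall s : R, s \in `[0, 1] -> `|B1 (t + s * (x - t))| <= t^-1.
    move=> s s01; have /andP[? ?] := B1_bnd (segment_ge (lexx t) tx s01).
    by rewrite ger0_norm.
  have At := FA t (ltW t0) (lexx t).
  rewrite -[B x](subrK (A t)) (le_trans (ler_normD _ _))//.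
  by rewrite (le_trans (lerD BA At))// mulrBr subrK.
- move=> x y x0 y0.
  have C1 : t^-1 <= Num.max t^-1 (2 * t ^- 2) by rewrite le_max lexx.
  have C2 : 2 * t ^- 2 <= Num.max t^-1 (2 * t ^- 2) by rewrite le_max lexx orbT.
  set C := Num.max _ _ in C1 C2 *.
  have h3 : 0 <= `|y - x| ^+ 3 / 6 by rewrite divr_ge0// exprn_ge0.
  have jump0 : 0 <= (y - x) ^+ 2 / t * (`|x - t| <= `|y - x|)%R%:R.
    by rewrite mulr_ge0// divr_ge0 ?sqr_ge0// ltW.
  have C0 : 0 <= C * `|y - x| ^+ 3 / 6.
    by rewrite -mulrA mulr_ge0// (le_trans _ C1)// invr_ge0 ltW.
  (* With [x] and [y] on the same side of [t], the third derivative controls the remainder, by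
     [1 / t] on the left and [2 / t^2] on the right. If [t] separates them, then
     [|x - t| <= |y - x|], so the indicator is [1] and the crossing bound is the second term. *)
  have [xt|tx] := leP x t; have [yt|ty] := leP y t.
  + rewrite -[y in A y](subrK x y) [y - x + x]addrC ler_wpDr//.
    apply: (@le_trans _ _ (t^-1 * `|y - x| ^+ 3 / 6)); last first.
      by rewrite -!mulrA ler_wpM2r.
    apply: (@taylor2 _ A A1 A2 A3) => s s01; [exact: dA|exact: dA1|exact: dA2|].
    by apply: A3_abs; [exact: segment_ge|exact: segment_le].
  + rewrite [`|x - t|]distrC (_ : (`|t - x| <= `|y - x|) = true); last first.
      by rewrite !ger0_norm ?subr_ge0 ?(le_trans xt) ?(ltW ty)// lerD2r ltW.
    rewrite mulr1 ler_wpDl// [leRHS]mulrC.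
    apply: (@taylor2_crossing _ A A1 A2 B B1 B2 t^-1 x t y); [| | |by rewrite Bt|by rewrite B1t].
    * by rewrite mulr_ge0// subr_ge0 // ltW.
    * move=> s s01; split; [exact: dA|exact: dA1|].
      by apply: A2_abs; [apply: segment_ge => //; exact: ltW|exact: segment_le].
    * move=> s s01 /=; have tz := segment_ge (lexx t) (ltW ty) s01.
      have z0 := lt_le_trans t0 tz.
      by split; [exact: dB|exact: dB1|exact: B2_bnd].
  + rewrite (_ : (`|x - t| <= `|y - x|) = true); last first.
      rewrite [`|y - x|]distrC !ger0_norm ?subr_ge0 ?(le_trans yt) ?(ltW tx)//.
      by rewrite lerD2l lerN2.
    rewrite mulr1 ler_wpDl// [leRHS]mulrC.
    apply: (@taylor2_crossing _ B B1 B2 A A1 A2 t^-1 x t y); [| | |by rewrite Bt|by rewrite B1t].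
    * by rewrite mulr_le0// subr_le0 // ltW.
    * move=> s s01 /=; have tz := segment_ge (ltW tx) (lexx t) s01.
      have z0 := lt_le_trans t0 tz.
      by split; [exact: dB|exact: dB1|exact: B2_bnd].
    * move=> s s01; split; [exact: dA|exact: dA1|].
      by apply: A2_abs; [apply: segment_ge => //; exact: ltW|exact: segment_le].
  + rewrite -[y in B y](subrK x y) [y - x + x]addrC ler_wpDr//.
    apply: (@le_trans _ _ (2 * t ^- 2 * `|y - x| ^+ 3 / 6)); last first.
      by rewrite -!mulrA [leLHS]mulrA ler_wpM2r.
    apply: (@taylor2 _ B B1 B2 B3) => s s01;
      have tz := segment_ge (ltW tx) (ltW ty) s01; have z0 := lt_le_trans t0 tz;
      [exact: dB|exact: dB1|exact: dB2|exact: B3_bnd].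
Qed.
End fixed_level.

End stein_equation.

(** * Taking bounded functions of [W] out of a conditional expectation *)

Section pull_out.
Local Open Scope ereal_scope.
Context d (T : measurableType d) (R : realType) (P : probability T R).
Variable W : {RV P >-> R}.
Import HBNNSimple.
Implicit Types (U X Y : T -> R) (h : R -> R).

(** The claim holds for simple functions increasing to [h], and passes to the limit by dominated
    convergence with dominating function [|U| M]. *)
Let pull_out_ge0 U h (M : R) : P.-integrable setT (EFin \o U) ->
  (forall A, g_sigma_algebra_preimage W A -> \int[P]_(w in A) (U w)%:E = 0) ->
  measurable_fun setT h -> (forall x, 0 <= h x)%R -> (forall w, h (W w) <= M)%R ->
  \int[P]_w (U w * h (W w))%:E = 0.
Proof.
move=> iU U0 mh h0 hM.
have mU : measurable_fun setT U by exact/measurable_EFinP/(measurable_int P).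
have meh : measurable_fun setT (EFin \o h) by exact/measurable_EFinP.
have eh0 x : setT x -> 0 <= (EFin \o h) x by move=> _; rewrite lee_fin.
pose u n := nnsfun_approx measurableT meh n.
have uh n x : (u n x <= h x)%R.
  by rewrite -lee_fin /u nnsfun_approxE; apply: le_approx.
have ucvg x : EFin \o u ^~ x @ \oo --> (h x)%:E.
  exact: (cvg_nnsfun_approx measurableT meh eh0).
have int0 n : \int[P]_w (U w * u n (W w))%:E = 0.
  have mpre y : measurable (W @^-1` (u n @^-1` [set y])).
    by rewrite -[X in measurable X]setTI; exact: measurable_funP.
  have iUy y : P.-integrable setT (EFin \o (U \* \1_(W @^-1` (u n @^-1` [set y])))%R).
    apply: (le_integrable measurableT _ _ iU).
      by apply/measurable_EFinP; apply: measurable_funM.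
    move=> w _ /=; rewrite lee_fin normrM ler_piMr// indicE.
    by case: (_ \in _); rewrite ?normr1 ?normr0.
  (* The simple function is the sum over its values [y] of [y] times the indicator of a level set.
     Composed with [W], each level set is an event of [sigma(W)], over which [U] integrates to
     [0]. *)
  transitivity (\int[P]_w \sum_(y <- finmap.enum_fset (fset_set (range (u n))))
      (y%:E * (U w * \1_(W @^-1` (u n @^-1` [set y])) w)%:E)).
    apply: eq_integral => w _; rewrite {1}(fimfunE (u n)) fsbig_finite//= mulr_sumr.
    rewrite -sumEFin; apply: eq_bigr => y _.
    by rewrite -EFinM mulrCA !indicE; congr ((_ * (_ * (nat_of_bool _)%:R))%:E);
      apply/idP/idP; rewrite !inE.
  rewrite (integral_sum measurableT (fun y => integrableZl measurableT y (iUy y))).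
  rewrite big1// => y _; rewrite integralZl//.
  have -> : \int[P]_w (EFin \o (U \* \1_(W @^-1` (u n @^-1` [set y])))%R) w =
      \int[P]_(w in W @^-1` (u n @^-1` [set y])) (U w)%:E.
    rewrite [RHS]integral_mkcond; apply: eq_integral => w _.
    by rewrite -patch_indic -restrict_EFin.
  by rewrite U0 ?mule0//; exists (u n @^-1` [set y]); rewrite ?setTI.
have mhW : measurable_fun setT (fun w => (U w * h (W w))%:E).
  by apply/measurable_EFinP; apply: measurable_funM => //; exact: measurableT_comp.
have muW n : measurable_fun setT (fun w => (U w * u n (W w))%:E).
  by apply/measurable_EFinP; apply: measurable_funM => //; exact: measurableT_comp.
have cvgU : {ae P, forall w, setT w ->
    (U w * u n (W w))%:E @[n --> \oo] --> (U w * h (W w))%:E}.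
  apply: aeW => w _; under eq_fun do rewrite EFinM.
  by rewrite EFinM; apply: cvgeZl => //; exact: ucvg.
have iUM : P.-integrable setT (fun w => (`|U w| * M)%:E).
  under eq_fun do rewrite EFinM muleC.
  by apply: integrableZl => //; exact: integrable_norm.
have domU : {ae P, forall w n, setT w ->
    `|(U w * u n (W w))%:E| <= (`|U w| * M)%:E}.
  apply: aeW => w n _; rewrite lee_fin normrM ler_wpM2l//.
  by rewrite ger0_norm// (le_trans (uh _ _)).
have [_ _] := dominated_convergence measurableT muW mhW cvgU iUM domU.
rewrite (_ : [sequence _]_n = cst 0); last exact/funext/int0.
by move=> H; apply/esym; apply: cvg_unique (cvg_cst _) H.
Qed.

Lemma integrable_bounded_mul U h (M : R) : P.-integrable setT (EFin \o U) ->
  measurable_fun setT h -> (forall w, `|h (W w)| <= M)%R ->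
  P.-integrable setT (EFin \o (fun w => U w * h (W w))%R).
Proof.
move=> iU mh hM.
have mU : measurable_fun setT U by exact/measurable_EFinP/(measurable_int P).
apply: (@le_integrable _ _ _ _ _ measurableT _ (fun w => M%:E * (U w)%:E)).
- by apply/measurable_EFinP; apply: measurable_funM => //; exact: measurableT_comp.
- move=> w _; rewrite /= lee_fin !normrM mulrC ler_wpM2r//.
  by rewrite (le_trans (hM w))// ler_norm.
- exact: integrableZl.
Qed.

(** The difference [X - Y] integrates to [0] over each event of [sigma(W)]. The bound on [h] is
    asked along [W] because the Stein solution is controlled on nonnegative reals only. *)
Lemma pull_out X Y h (M : R) :
  P.-integrable setT (EFin \o X) -> P.-integrable setT (EFin \o Y) ->
  (forall A, g_sigma_algebra_preimage W A ->
    \int[P]_(w in A) (Y w)%:E = \int[P]_(w in A) (X w)%:E) ->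
  measurable_fun setT h -> (forall w, `|h (W w)| <= M)%R ->
  (\int[P]_w (X w * h (W w)) = \int[P]_w (Y w * h (W w)))%R.
Proof.
move=> iX iY XY mh hM.
have iU : P.-integrable setT (EFin \o (X \- Y)%R).
  by rewrite (_ : _ \o _ = (EFin \o X) \- (EFin \o Y)) //; exact: integrableB.
have U0 A : g_sigma_algebra_preimage W A -> \int[P]_(w in A) (X w - Y w)%:E = 0.
  move=> WA; have mA : measurable A.
    by case: WA => B mB <-; exact: measurable_funP.
  rewrite integralB_EFin//; [|exact: integrableS iX|exact: integrableS iY].
  rewrite XY// subee// integrable_fin_num//; exact: integrableS iX.
apply/eqP; rewrite -subr_eq0 -RintegralB//; first last.
  exact: integrable_bounded_mul iY mh hM.
  exact: integrable_bounded_mul iX mh hM.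
have h'M w : (`|h (W w) + M| <= `|M| + `|M|)%R.
  by rewrite (le_trans (ler_normD _ _))// lerD2r (le_trans (hM w))// ler_norm.
have mh' : measurable_fun setT (fun x => `|h x + M|)%R.
  by apply: measurableT_comp => //; apply: measurable_funD.
have h'M' w : (`| `|h (W w) + M| | <= `|M| + `|M|)%R by rewrite normr_id.
(* Shifting [h] by [M] reduces to a nonnegative multiplier. *)
have -> : (\int[P]_w (X w * h (W w) - Y w * h (W w)) =
    \int[P]_w ((X w - Y w) * `|h (W w) + M| - M * (X w - Y w)))%R.
  apply: eq_Rintegral => w _.
  have := hM w; rewrite ler_norml => /andP[hM0 _].
  by rewrite ger0_norm; [ring|rewrite -lerBlDr sub0r].
rewrite RintegralB//; first last.
  exact: (integrableZl measurableT M iU).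
  exact: (integrable_bounded_mul iU mh' h'M').
rewrite RintegralZl// /Rintegral (U0 setT); last first.
  by exists setT => //; rewrite setTI preimage_setT.
by rewrite (pull_out_ge0 iU U0 mh' (fun x => normr_ge0 _) h'M)/= mulr0 subr0.
Qed.

End pull_out.

(** * Distribution functions and expectations as functionals of the law *)

Section laws.
Local Open Scope ereal_scope.
Context d (T : measurableType d) (R : realType) (P : probability T R).

Lemma sublevelE (X : T -> R) (t : R) : [set w | (X w <= t)%R] = X @^-1` `]-oo, t].
Proof. by apply/seteqP; split=> w/=; rewrite in_itv. Qed.

Lemma measurable_sublevel (X : {RV P >-> R}) (t : R) :
  measurable [set w | (X w <= t)%R].
Proof.
by rewrite sublevelE -[X in measurable X]setTI; exact: measurable_funP.
Qed.

Lemma exponential_mean1_cdf (Z : {RV P >-> R}) (t : R) :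
  exponential_mean1 Z -> (0 < t)%R ->
  P [set z | (Z z <= t)%R] = (1 - expR (- t))%:E.
Proof.
move=> Zexp t0.
rewrite sublevelE -[LHS]/(distribution P Z `]-oo, t]) Zexp//.
rewrite EFinB -(mulN1r t) -exponential_prob_itv0c//.
(* The density vanishes on negative reals, so integrating over []-oo, t]] or over [[0, t]] gives the
   same value. *)
rewrite /exponential_prob integral_mkcond [RHS]integral_mkcond.
apply: eq_integral => x _; rewrite !patchE; have [x0|x0] := leP 0%R x.
  by congr (if _ then _ else _); apply/idP/idP; rewrite !inE/= !in_itv/= x0.
by rewrite lt0_exponential_pdf// !if_same.
Qed.

Lemma same_law_Rintegral (W W' : {RV P >-> R}) (F : R -> R) :
  same_law W W' -> measurable_fun setT F ->
  P.-integrable setT (EFin \o (F \o W)) -> P.-integrable setT (EFin \o (F \o W')) ->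
  (\int[P]_w F (W' w) = \int[P]_w F (W w))%R.
Proof.
move=> WW' mF iF iF'; have meF : measurable_fun setT (EFin \o F) by exact/measurable_EFinP.
rewrite /Rintegral; congr fine.
rewrite -[LHS](integral_distribution meF iF') -[RHS](integral_distribution meF iF).
by apply: eq_measure_integral => A mA _; exact: esym (WW' A mA).
Qed.

End laws.

(** * Linear combinations of integrable real functions *)

Section real_integrable.
Context d (T : measurableType d) (R : realType) (mu : {measure set T -> \bar R}).
Implicit Types f g : T -> R.

Lemma integrable_EFinD f g :
  mu.-integrable setT (EFin \o f) -> mu.-integrable setT (EFin \o g) ->
  mu.-integrable setT (EFin \o (fun w => f w + g w)).
Proof. exact: integrableD. Qed.

Lemma integrable_EFinB f g :
  mu.-integrable setT (EFin \o f) -> mu.-integrable setT (EFin \o g) ->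
  mu.-integrable setT (EFin \o (fun w => f w - g w)).
Proof. exact: integrableB. Qed.

Lemma integrable_EFinZ k f :
  mu.-integrable setT (EFin \o f) ->
  mu.-integrable setT (EFin \o (fun w => k * f w)).
Proof. exact: integrableZl. Qed.

End real_integrable.

(** * The bound between real numbers, for [D] with finite third absolute moment *)

Section stein_bound.
Context d (T : measurableType d) (R : realType) (P : probability T R).
Variables (W W' : {RV P >-> R}) (Y : T -> R) (lambda t : R).
Hypotheses (W_ge0 : forall w, 0 <= W w) (W'_ge0 : forall w, 0 <= W' w).
Hypothesis WW' : same_law W W'.
Hypotheses (lambda_gt0 : 0 < lambda) (t_gt0 : 0 < t).

Let D w := W' w - W w.

Hypothesis iW : P.-integrable setT (EFin \o W).
Hypothesis iD : P.-integrable setT (EFin \o D).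
Hypothesis iD3 : P.-integrable setT (EFin \o (fun w => `|D w| ^+ 3)).
Hypothesis iY : P.-integrable setT (EFin \o Y).
Hypothesis ED : forall A, g_sigma_algebra_preimage W A ->
  (\int[P]_(w in A) (- lambda * (W w - 1))%:E = \int[P]_(w in A) (D w)%:E)%E.
Hypothesis EY : forall A, g_sigma_algebra_preimage W A ->
  (\int[P]_(w in A) (Y w)%:E = \int[P]_(w in A) (D w ^+ 2)%:E)%E.

Let near_t := [set v | `|W v - t| <= `|D v|].

Lemma measurable_near_level : measurable near_t.
Proof.
have mD : measurable_fun setT D by exact/measurable_EFinP/(measurable_int P).
have mle : measurable_fun setT (fun v => `|W v - t| <= `|D v|).
  apply: measurable_fun_ler; apply: measurableT_comp => //.
  exact: measurable_funB.
by have := mle measurableT [set true] ltac:(done); rewrite setTI.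
Qed.

(** For [r >= 0], [r^2 <= 1 + r^3], and constants are integrable under a probability. *)
Lemma integrable_sqr_of_cube : P.-integrable setT (EFin \o (fun w => D w ^+ 2)).
Proof.
have mD : measurable_fun setT D by exact/measurable_EFinP/(measurable_int P).
have i1D3 : P.-integrable setT (EFin \o (fun w => 1 + `|D w| ^+ 3)).
  rewrite (_ : _ \o _ = (cst 1%:E \+ (EFin \o (fun w => `|D w| ^+ 3)%R))%E)//.
  by apply: integrableD => //; exact: finite_measure_integrable_cst.
apply: (le_integrable measurableT _ _ i1D3).
  by apply/measurable_EFinP; exact: measurable_funX.
move=> w _ /=; rewrite lee_fin normrX [leRHS]ger0_norm ?addr_ge0 ?exprn_ge0//.
have := normr_ge0 (D w); move: `|D w| => r r0.
have [r1|/ltW r1] := leP r 1.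
  apply: (@le_trans _ _ 1); first exact: exprn_ile1.
  by rewrite lerDl exprn_ge0.
by rewrite ler_wpDl// [leRHS]exprS ler_peMl// exprn_ge0.
Qed.

Lemma integrable_sqr_near_level :
  P.-integrable setT (EFin \o (fun w => D w ^+ 2 * \1_near_t w)).
Proof.
have mD : measurable_fun setT D by exact/measurable_EFinP/(measurable_int P).
apply: (le_integrable measurableT _ _ integrable_sqr_of_cube).
  apply/measurable_EFinP; apply: measurable_funM; first exact: measurable_funX.
  exact: measurable_indic measurable_near_level.
move=> w _ /=; rewrite lee_fin normrM ler_piMr// indicE.
by case: (_ \in _); rewrite ?normr1 ?normr0.
Qed.

Lemma exponential_stein_bound :
  `|fine (P [set w | W w <= t]) - (1 - expR (- t))| <=
    (\int[P]_w `|2 * lambda * W w - Y w|) / (2 * lambda * t)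
    + (\int[P]_w (`|D w| ^+ 3)) * (Num.max t^-1 (2 * t ^- 2) / (6 * lambda))
    + (\int[P]_w (D w ^+ 2 * \1_near_t w)) / (lambda * t).
Proof.
have [F [f [f' [[mF mf mf'] stein bnd taylor]]]] := exponential_stein_solution t_gt0.
set C := Num.max _ _ in taylor *.
have bF x : 0 <= x -> `|F x| <= t^-1 * x by move=> /bnd[].
have bf w : `|f (W w)| <= t^-1 by have [] := bnd _ (W_ge0 w).
have bf' w : `|f' (W w)| <= t^-1 by have [] := bnd _ (W_ge0 w).
have mD : measurable_fun setT D by exact/measurable_EFinP/(measurable_int P).
have iD2 := integrable_sqr_of_cube.
have iD2n := integrable_sqr_near_level.
have iW' : P.-integrable setT (EFin \o W').
  rewrite (_ : EFin \o W' = ((EFin \o W) \+ (EFin \o D))%E); first exact: integrableD.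
  by apply/funext => w /=; rewrite -EFinD /D addrC subrK.
(* [F] grows at most linearly on nonnegative reals, so it inherits integrability from [W] and
   [W']. *)
have iFX (X : {RV P >-> R}) : (forall w, 0 <= X w) ->
    P.-integrable setT (EFin \o X) -> P.-integrable setT (EFin \o (F \o X)).
  move=> X0 iX.
  apply: (@le_integrable _ _ _ _ _ measurableT _ (fun w => (t^-1)%:E * (X w)%:E)%E).
  - by apply/measurable_EFinP; exact: measurableT_comp.
  - move=> w _ /=; rewrite lee_fin (le_trans (bF _ (X0 w)))// ler_norm//.
  - exact: integrableZl.
have iFW := iFX W W_ge0 iW; have iFW' := iFX W' W'_ge0 iW'.
have iW1 : P.-integrable setT (EFin \o (fun w => W w - 1)).
  by apply: integrable_EFinB => //; exact: finite_measure_integrable_cst.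
have iV := integrable_EFinZ (- lambda) iW1.
have iW1f := integrable_bounded_mul iW1 mf bf.
have iDf := integrable_bounded_mul iD mf bf.
have iWf' := integrable_bounded_mul iW mf' bf'.
have iYf' := integrable_bounded_mul iY mf' bf'.
have iD2f' := integrable_bounded_mul iD2 mf' bf'.
have EF := same_law_Rintegral WW' mF iFW iFW'.
have EDf := pull_out iD iV ED mf bf.
have EYf' := pull_out iD2 iY EY mf' bf'.
pose Rem w := F (W' w) - F (W w) - D w * f (W w) - 2^-1 * (D w ^+ 2 * f' (W w)).
have iFB := integrable_EFinB iFW' iFW.
have iFBD := integrable_EFinB iFB iDf.
have iRem := integrable_EFinB iFBD (integrable_EFinZ 2^-1 iD2f').
(* The difference [F W' - F W] has mean [0] by equality of laws; conditioning on [W] replaces [D] by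
   [- lambda (W - 1)] and [D^2] by [Y]. *)
have RemE : \int[P]_w Rem w =
    lambda * \int[P]_w ((W w - 1) * f (W w)) - 2^-1 * \int[P]_w (Y w * f' (W w)).
  rewrite (RintegralB measurableT iFBD (integrable_EFinZ 2^-1 iD2f')).
  rewrite (RintegralB measurableT iFB iDf) (RintegralB measurableT iFW' iFW).
  rewrite EF EDf subrr sub0r RintegralZl// EYf'; congr (_ - _).
  under eq_Rintegral do rewrite -mulrA.
  by rewrite RintegralZl// mulNr opprK.
have mWt := measurable_sublevel W t.
have steinE : fine (P [set w | W w <= t]) - (1 - expR (- t)) =
    \int[P]_w (W w * f' (W w)) - \int[P]_w ((W w - 1) * f (W w)).
  rewrite -RintegralB//.
  transitivity (\int[P]_w (\1_[set w | W w <= t] w - (1 - expR (- t)))).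
    rewrite RintegralB//; first last.
    - exact: finite_measure_integrable_cst.
    - exact: integrable_indic.
    rewrite Rintegral_cst//.
    rewrite [X in _ * X](_ : _ = 1) ?mulr1; last first.
      exact: (congr1 fine (probability_setT P)).
    by rewrite /Rintegral integral_indic// setIT.
  apply: eq_Rintegral => w _; rewrite stein// indicE.
  by congr (_%:R - _); congr nat_of_bool; apply/idP/idP; rewrite inE.
(* The mean of [(W - 1) f W] is eliminated between the integrated Stein equation and the expression
   for the mean remainder. *)
have main : fine (P [set w | W w <= t]) - (1 - expR (- t)) =
    (2 * lambda)^-1 * \int[P]_w ((2 * lambda * W w - Y w) * f' (W w))
    - lambda^-1 * \int[P]_w Rem w.
  rewrite steinE RemE.
  have -> : \int[P]_w ((2 * lambda * W w - Y w) * f' (W w)) =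
      2 * lambda * \int[P]_w (W w * f' (W w)) - \int[P]_w (Y w * f' (W w)).
    rewrite -RintegralZl// -RintegralB//; last exact: integrable_EFinZ.
    by apply: eq_Rintegral => w _; rewrite mulrBl -!mulrA.
  by field; rewrite gt_eqF.
have iLY := integrable_EFinB (integrable_EFinZ (2 * lambda) iW) iY.
have bnd1 : `|\int[P]_w ((2 * lambda * W w - Y w) * f' (W w))| <=
    \int[P]_w `|2 * lambda * W w - Y w| * t^-1.
  have iLYf' := integrable_bounded_mul iLY mf' bf'.
  apply: (le_trans (le_normr_Rintegral measurableT iLYf')).
  rewrite -RintegralZr//; last exact: integrable_norm.
  apply: le_Rintegral => //; first exact: integrable_norm.
    under [_ \o _]eq_fun do rewrite mulrC.
    exact: integrable_EFinZ (integrable_norm iLY).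
  by move=> w _; rewrite normrM ler_wpM2l.
(* The pointwise Taylor estimate at [x = W w], [y = W' w] is integrated; its indicator is that of
   [near_t]. *)
have bnd2 : `|\int[P]_w Rem w| <=
    C / 6 * \int[P]_w (`|D w| ^+ 3) + t^-1 * \int[P]_w (D w ^+ 2 * \1_near_t w).
  have i1 := integrable_EFinZ (C / 6) iD3.
  have i2 := integrable_EFinZ t^-1 iD2n.
  apply: (le_trans (le_normr_Rintegral measurableT iRem)).
  rewrite -!RintegralZl// -RintegralD//.
  apply: le_Rintegral => //; [exact: integrable_norm|exact: integrable_EFinD|].
  move=> w _; have := taylor _ _ (W_ge0 w) (W'_ge0 w).
  rewrite -/(D w) -/C /Rem indicE => le_tay.
  rewrite (_ : 2^-1 * _ = D w ^+ 2 / 2 * f' (W w)); last by field.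
  apply: (le_trans le_tay).
  rewrite (_ : (w \in near_t) = (`|W w - t| <= `|D w|)); last first.
    by apply/idP/idP; rewrite inE.
  by rewrite le_eqVlt; apply/orP; left; apply/eqP; field; rewrite gt_eqF.
have l1 : 0 <= (2 * lambda)^-1 by rewrite invr_ge0 mulr_ge0// ltW.
have l2 : 0 <= lambda^-1 by rewrite invr_ge0 ltW.
rewrite main (le_trans (ler_normB _ _))// !normrM (ger0_norm l1) (ger0_norm l2).
apply: (le_trans (lerD (ler_wpM2l l1 bnd1) (ler_wpM2l l2 bnd2))).
rewrite le_eqVlt; apply/orP; left; apply/eqP; field.
by rewrite !gt_eqF.
Qed.

End stein_bound.

(** * Real-valued versions of conditional expectations *)

Section conditional_expectation.
Local Open Scope ereal_scope.
Context d (T : measurableType d) (R : realType) (P : probability T R).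
Variable W : {RV P >-> R}.

Lemma measurable_g_sigma_algebra_preimage (Y : T -> \bar R) :
  measurable_fun [set: g_sigma_algebra_preimageType W] Y ->
  measurable_fun setT Y.
Proof.
move=> mY _ B mB; have [C mC <-] := mY measurableT B mB.
exact: measurable_funP.
Qed.

(** In the nonnegative case, testing on the whole space shows that [Y] and [X] have the same finite
    integral. *)
Lemma integrable_cond_exp X Y : is_cond_exp W X Y ->
  P.-integrable setT X -> P.-integrable setT Y.
Proof.
move=> [[X0|[]//] mY XY] iX.
have mY' := measurable_g_sigma_algebra_preimage mY.
apply/integrableP; split => //.
under eq_integral do rewrite gee0_abs ?(X0 _).2//.
rewrite XY; last by exists setT => //; rewrite setTI preimage_setT.
exact: integrable_lty.
Qed.

(** An integrable version is finite almost everywhere, so sending its infinite values to [0] changes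
    it on a null set only. This reduces an extended-real version to a real one. *)
Lemma cond_exp_fine (X Y : T -> \bar R) : is_cond_exp W X Y ->
  P.-integrable setT X ->
  [/\ P.-integrable setT (EFin \o (fine \o Y)),
      ae_eq P setT (EFin \o (fine \o Y)) Y &
      forall A, g_sigma_algebra_preimage W A ->
        \int[P]_(w in A) (fine (Y w))%:E = \int[P]_(w in A) X w].
Proof.
move=> XY iX; have iY := integrable_cond_exp XY iX.
case: XY => _ mY XY.
have mY' := measurable_g_sigma_algebra_preimage mY.
have mfY : measurable_fun setT (EFin \o (fine \o Y)).
  by apply/measurable_EFinP; exact: measurableT_comp.
have aeY : ae_eq P setT (EFin \o (fine \o Y)) Y.
  have := integrable_ae measurableT iY.
  by apply: filterS => w Yfin wT /=; rewrite fineK ?Yfin.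
split => //.
  apply: (le_integrable measurableT mfY _ iY) => w _ /=.
  by case: (Y w) => [r| |] /=; rewrite ?normr0 ?leey.
move=> A WA; rewrite -XY//.
have mA : measurable A by case: WA => B mB <-; exact: measurable_funP.
apply: ae_eq_integral => //; [exact: measurable_funTS|exact: measurable_funTS|].
by move: aeY; apply: filterS => w /(_ I).
Qed.

End conditional_expectation.

Local Open Scope ereal_scope.

Theorem theorem1p2 (R : realType)
    (d : measure_display) (T : measurableType d) (P : probability T R)
    (W W' : {RV P >-> R})
    (W_ge0 : forall w, (0 <= W w)%R) (W'_ge0 : forall w, (0 <= W' w)%R)
    (WW' : same_law W W')
    (D : T -> R) (DE : forall w, D w = (W' w - W w)%R)
    (lambda : R) (lambda_gt0 : (0 < lambda)%R)
    (ED : is_cond_exp W (fun w => (D w)%:E)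
                        (fun w => (- lambda * (W w - 1))%:E))
    (ED2 : T -> \bar R)
    (ED2P : is_cond_exp W (fun w => (D w ^+ 2)%:E) ED2)
    (d' : measure_display) (T' : measurableType d') (P' : probability T' R)
    (Z : {RV P' >-> R}) (Zexp : exponential_mean1 Z)
    (t : R) (t_gt0 : (0 < t)%R) :
  `| P [set w | (W w <= t)%R] - P' [set z | (Z z <= t)%R] | <=
    (\int[P]_w `| (2 * lambda * W w)%:E - ED2 w |) * ((2 * lambda * t)^-1)%:E
  + 'E_P[fun w => (`|D w| ^+ 3)%R]
      * (Num.max t^-1 (2 * t ^- 2) / (6 * lambda))%:E
  + 'E_P[fun w => (D w ^+ 2 * \1_[set v | `|W v - t| <= `|D v|] w)%R]
      * ((lambda * t)^-1)%:E.
Proof.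
have {DE} D_eq : D = (fun w => W' w - W w)%R by exact/funext.
subst D; rewrite !unlock.
pose D w := (W' w - W w)%R.
have C_gt0 : (0 < Num.max t^-1 (2 * t ^- 2) / (6 * lambda))%R.
  by rewrite divr_gt0 ?mulr_gt0// lt_max invr_gt0 t_gt0.
have i1 : P.-integrable setT (EFin \o cst 1%R) by exact: finite_measure_integrable_cst.
(* If the conditional expectation is taken in the nonnegative sense, [- lambda (W - 1) >= 0] forces
   [W <= 1]. Otherwise [W] is an affine function of the integrable [- lambda (W - 1)]. *)
have iW : P.-integrable setT (EFin \o W).
  case: ED => [[V0|[_ iV]] _ _].
    apply: (le_integrable measurableT _ _ i1).
      exact/measurable_EFinP.
    move=> w _ /=; rewrite lee_fin normr1 ger0_norm//.
    have [_] := V0 w; rewrite lee_fin mulNr oppr_ge0 pmulr_rle0// subr_le0.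
    by [].
  have := integrable_EFinB i1 (integrable_EFinZ lambda^-1 iV).
  congr (_.-integrable _ _); apply/funext => w /=; congr EFin.
  by field; rewrite gt_eqF.
have iV : P.-integrable setT (EFin \o (fun w => - lambda * (W w - 1))%R).
  by apply: integrable_EFinZ; apply: integrable_EFinB => //; exact: finite_measure_integrable_cst.
have mD : measurable_fun setT D by exact: measurable_funB.
(* In the nonnegative case, the integral of [D] over the whole space equals that of the integrable
   [- lambda (W - 1)]. *)
have iD : P.-integrable setT (EFin \o D).
  case: ED => [[V0|[]//] _ EDW].
  apply/integrableP; split; first exact/measurable_EFinP.
  under eq_integral do rewrite gee0_abs ?(V0 _).1//.
  rewrite -EDW; last by exists setT => //; rewrite setTI preimage_setT.
  exact: integrable_lty.
have D3_ge0 : 0 <= \int[P]_w (`|D w| ^+ 3)%:E.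
  by apply: integral_ge0 => w _; rewrite lee_fin exprn_ge0.
have D2_ge0 : 0 <= \int[P]_w (D w ^+ 2 * \1_[set v | (`|W v - t| <= `|D v|)%R] w)%:E.
  by apply: integral_ge0 => w _; rewrite lee_fin mulr_ge0 ?sqr_ge0.
have EDW_ge0 : 0 <= \int[P]_w `|(2 * lambda * W w)%:E - ED2 w|.
  by apply: integral_ge0.
(* An infinite third moment makes the right-hand side [+oo], since the other two terms are
   nonnegative and the constant factor is positive. *)
have [D3oo|] := eqVneq (\int[P]_w (`|D w| ^+ 3)%:E) +oo.
  rewrite D3oo gt0_mulye ?lte_fin// addey; last first.
    by rewrite gt_eqF// (lt_le_trans (ltNyr 0))// mule_ge0// lee_fin invr_ge0 !mulr_ge0// ltW.
  rewrite addye ?leey// gt_eqF// (lt_le_trans (ltNyr 0))// mule_ge0//.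
  by rewrite lee_fin invr_ge0 mulr_ge0// ltW.
rewrite -ltey => D3fin.
have iD3 : P.-integrable setT (EFin \o (fun w => `|D w| ^+ 3)%R).
  apply/integrableP; split.
    by apply/measurable_EFinP; apply: measurable_funX; exact: measurableT_comp.
  by under eq_integral do rewrite gee0_abs ?lee_fin ?exprn_ge0//.
have iD2 := integrable_sqr_of_cube iD iD3.
have [iY aeY EY] := cond_exp_fine ED2P iD2.
have [_ _ EDW] := ED.
have := exponential_stein_bound W_ge0 W'_ge0 WW' lambda_gt0 t_gt0 iW iD iD3 iY EDW EY.
have iD2n := integrable_sqr_near_level t iD iD3.
have iLY := integrable_norm (integrable_EFinB (integrable_EFinZ (2 * lambda) iW) iY).
rewrite (exponential_mean1_cdf Zexp t_gt0).
(* Replacing [ED2] by its real version leaves the integral unchanged, as they agree almost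
   everywhere. *)
have -> : \int[P]_w `|(2 * lambda * W w)%:E - ED2 w| =
    \int[P]_w (`|2 * lambda * W w - fine (ED2 w)|)%:E.
  apply: ae_eq_integral => //.
  - apply: measurableT_comp => //; apply: emeasurable_funB.
      by apply/measurable_EFinP; exact: measurable_funM.
    by case: ED2P => _ mED2 _; exact: measurable_g_sigma_algebra_preimage mED2.
  - exact: (measurable_int P iLY).
  - by move: aeY; apply: filterS => w + wT => /(_ I) <-.
move=> bound.
(* Every integral is now finite, so the inequality is the image of the one between reals. *)
rewrite -[P _]fineK; last exact/fin_num_measure/measurable_sublevel.
rewrite -EFinB abse_EFin.
rewrite -[\int[P]_w (`|_|)%:E]fineK; last exact: integrable_fin_num iLY.
rewrite -[\int[P]_w (`|_| ^+ 3)%:E]fineK; last exact: integrable_fin_num iD3.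
rewrite -[\int[P]_w (_ * \1_ _ _)%:E]fineK; last exact: integrable_fin_num iD2n.
by rewrite -!EFinM -!EFinD lee_fin.
Qed.
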